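(* Let $H^L$ and $\blacktriangleright$ be as in the context, and for $\alpha=1,\dots,n$ let $\hat y_\alpha:=\hat x_\beta(\mathcal O^{-1})^\beta_\alpha\in H^L$. Then for all $\hat f,\hat g\in U(\mathfrak g^L)$: (1) $\hat x_\alpha\hat f=(\mathcal O^\beta_\alpha\blacktriangleright\hat f)\,\hat x_\beta$; (2) $\mathcal O^\gamma_\alpha\blacktriangleright(\hat g\hat f)=(\mathcal O^\beta_\alpha\blacktriangleright\hat g)(\mathcal O^\gamma_\beta\blacktriangleright\hat f)$; (3) $(\mathcal O^{-1})^\gamma_\alpha\blacktriangleright(\hat g\hat f)=((\mathcal O^{-1})^\gamma_\beta\blacktriangleright\hat g)((\mathcal O^{-1})^\beta_\alpha\blacktriangleright\hat f)$; (4) $\hat y_\alpha\blacktriangleright\hat f=\hat f\hat x_\alpha$; (5) $(\hat x_\alpha\blacktriangleright\hat f)\hat g=(\mathcal O^\beta_\alpha\blacktriangleright\hat f)(\hat x_\beta\blacktriangleright\hat g)$.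
   Context: Let $k$ be a field of characteristic zero and $\mathfrak g$ a Lie algebra over $k$ of finite dimension $n$ with basis $\hat x_1,\dots,\hat x_n$ and $[\hat x_\mu,\hat x_\nu]=C^\lambda_{\mu\nu}\hat x_\lambda$. Summation over repeated indices is understood. Write $U(\mathfrak g^L):=U(\mathfrak g)$, a cocommutative Hopf algebra with $\hat x_\mu$ primitive; Sweedler notation $\Delta(u)=\sum u_{(1)}\otimes u_{(2)}$, counit $\epsilon$. Let $\hat S(\mathfrak g^* ):=k[[\partial^1,\dots,\partial^n]]$ (commutative formal power series) and $\epsilon_S:\hat S(\mathfrak g^* )\to k$ the constant-term map. Let $\mathcal C$ be the $n\times n$ matrix with entries $\mathcal C^\alpha_\beta:=C^\alpha_{\beta\gamma}\partial^\gamma$, $\phi:=\frac{-\mathcal C}{e^{-\mathcal C}-1}=\sum_{N\ge0}\frac{(-1)^NB_N}{N!}\mathcal C^N$ ($B_N$ Bernoulli numbers), and $\mathcal O:=e^{\mathcal C}$, with inverse $\mathcal O^{-1}=e^{-\mathcal C}$ (entries in $\hat S(\mathfrak g^* )$). It is known (and assumed) that there is a unique right Hopf action $\triangleleft$ of $U(\mathfrak g^L)$ on $\hat S(\mathfrak g^* )$ (i.e. $(a\triangleleft u)\triangleleft v=a\triangleleft(uv)$, $(ab)\triangleleft u=\sum(a\triangleleft u_{(1)})(b\triangleleft u_{(2)})$, $1\triangleleft u=\epsilon(u)1$) such that $a\mapsto a\triangleleft\hat x_\alpha$ is the continuous derivation sending $\partial^\beta\mapsto\phi^\beta_\alpha$.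 $H^L=U(\mathfrak g^L)\sharp\hat S(\mathfrak g^* )$ is the vector space $U(\mathfrak g^L)\otimes\hat S(\mathfrak g^* )$ with product $(u\sharp a)(u'\sharp a')=\sum uu'_{(1)}\sharp(a\triangleleft u'_{(2)})a'$, where $u\equiv u\sharp1$, $a\equiv1\sharp a$ (so $[\partial^\mu,\hat x_\nu]=\phi^\mu_\nu$). The (left) black action $\blacktriangleright:H^L\otimes U(\mathfrak g^L)\to U(\mathfrak g^L)$ is $h\blacktriangleright\hat f:=(\mathrm{id}\otimes\epsilon_S)(h\hat f)$, where the product $h\hat f$ is taken in $H^L$ and viewed as an element of $U(\mathfrak g^L)\otimes\hat S(\mathfrak g^* )$; it is the action of $H^L$ on $U(\mathfrak g^L)$ with $\partial^\mu\blacktriangleright1=0$ and $\hat f\blacktriangleright 1=\hat f$. *)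

(* Defs.v *)
From HB Require Import structures.
From mathcomp Require Import all_boot all_order all_algebra.
From mathcomp Require Import mpoly.
Set Implicit Arguments. Unset Strict Implicit. Unset Printing Implicit Defensive.
Import Order.TTheory GRing.Theory Num.Theory.
Local Open Scope ring_scope.

Section Defs.
Variables (R : fieldType) (n : nat).
(* Structure constants: C l m v = C^l_{m v}, i.e. [x_m, x_v] = C^l_{m v} x_l. *)
Variable C : 'I_n -> 'I_n -> 'I_n -> R.

Definition lie_antisym := forall l m v, C l m v = - C l v m.
Definition lie_jacobi := forall k m v r,
  \sum_(l < n) (C l m v * C k l r + C l v r * C k l m + C l r m * C k l v) = 0.

Definition alg_hom (A B : algType R) (f : A -> B) :=
  [/\ forall (c : R) (a b : A), f (c *: a + b) = c *: f a + f b,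
      forall a b : A, f (a * b) = f a * f b & f 1 = 1].

Definition lie_rel (A : algType R) (a : 'I_n -> A) :=
  forall m v, a m * a v - a v * a m = \sum_(l < n) C l m v *: a l.

Definition is_enveloping (U : algType R) (x : 'I_n -> U) :=
  lie_rel x /\
  forall (A : algType R) (a : 'I_n -> A), lie_rel a ->
    (exists f : U -> A, alg_hom f /\ forall i, f (x i) = a i) /\
    (forall f g : U -> A, alg_hom f -> alg_hom g ->
       (forall i, f (x i) = g (x i)) -> forall u, f u = g u).

Definition ps := 'X_{1..n} -> R.
Definition ps_eps (a : ps) : R := a (@mnm0 n).
Definition psC (c : R) : ps := fun m => if m == @mnm0 n then c else 0.
Definition psX (i : 'I_n) : ps := fun m => if m == mnm1 i then 1 else 0.
Definition ps_add (a b : ps) : ps := fun m => a m + b m.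
Definition ps_opp (a : ps) : ps := fun m => - a m.
Definition ps_scale (c : R) (a : ps) : ps := fun m => c * a m.
Definition ps_mul (a b : ps) : ps := fun m =>
  \sum_(p : 'X_{1..n < (mdeg m).+1} | lem p m) a p * b (mnm_sub m p).
Definition ps_sum (I : finType) (F : I -> ps) : ps := fun m => \sum_(i : I) F i m.
Definition ps_deriv (i : 'I_n) (a : ps) : ps := fun m =>
  (m i).+1%:R * a (mnm_add m (mnm1 i)).
(* sum of a series sum_N F N, where F N has order >= N (so the sum converges
   in the (d)-adic topology): coefficient of m only involves N <= deg m *)
Definition ps_series (F : nat -> ps) : ps := fun m =>
  \sum_(N < (mdeg m).+1) F N m.

Definition psmat := 'I_n -> 'I_n -> ps.   (* M a b = M^a_b *)
Definition psmat_mul (A B : psmat) : psmat := fun a b =>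
  ps_sum (fun d : 'I_n => ps_mul (A a d) (B d b)).
Definition psmat_id : psmat := fun a b => psC (a == b)%:R.
Definition psmat_pow (A : psmat) (N : nat) : psmat := iter N (psmat_mul A) psmat_id.
Definition psmat_opp (A : psmat) : psmat := fun a b => ps_opp (A a b).
(* sum_N c_N A^N for A with entries of order >= 1 *)
Definition psmat_series (c : nat -> R) (A : psmat) : psmat := fun a b =>
  ps_series (fun N => ps_scale (c N) (psmat_pow A N a b)).
Definition psmat_exp (A : psmat) : psmat := psmat_series (fun N => (N`!%:R)^-1) A.

(* Bernoulli numbers, B_0 = 1, B_1 = -1/2, sum_{k<=m} C(m+1,k) B_k = 0 (m >= 1) *)
Fixpoint bern_list (m : nat) : seq R :=
  match m with
  | 0 => [:: 1]
  | m'.+1 => let s := bern_list m' in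
      rcons s (- (m'.+2%:R)^-1 *
               \sum_(k < m'.+1) ('C(m'.+2, k))%:R * nth 0 s k)
  end.
Definition bernoulli (N : nat) : R := nth 0 (bern_list N) N.

Definition Cmat : psmat := fun a b =>
  ps_sum (fun g : 'I_n => ps_scale (C a b g) (psX g)).
(* phi = -C/(e^{-C}-1) = sum_N (-1)^N B_N / N! C^N *)
Definition phi : psmat :=
  psmat_series (fun N => (-1) ^+ N * bernoulli N / N`!%:R) Cmat.
Definition Omat : psmat := psmat_exp Cmat.
Definition Oinv : psmat := psmat_exp (psmat_opp Cmat).

(* the continuous derivation a |-> a <| x_alpha with d^b |-> phi^b_alpha *)
Definition Dact (al : 'I_n) (a : ps) : ps :=
  ps_sum (fun b : 'I_n => ps_mul (ps_deriv b a) (phi b al)).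

(* H is an algebra with embeddings iU of U and iS of k[[d]] (so u # a =
   iU u * iS a), the smash-product cross relation
     a x_nu = x_nu a + (a <| x_nu)    (Delta x = x (x) 1 + 1 (x) x),
   and pr = id (x) eps_S : H -> U. *)
Definition smash_product (U : algType R) (x : 'I_n -> U)
  (H : algType R) (iU : U -> H) (iS : ps -> H) (pr : H -> U) :=
  [/\ alg_hom iU,
      (forall a b, iS (ps_add a b) = iS a + iS b)
      /\ (forall c a, iS (ps_scale c a) = c *: iS a),
      (forall a b, iS (ps_mul a b) = iS a * iS b) /\ iS (psC 1) = 1,
      (forall a v, iS a * iU (x v) = iU (x v) * iS a + iS (Dact v a))
    & (forall (c : R) (h h' : H), pr (c *: h + h') = c *: pr h + pr h')
      /\ (forall u a, pr (iU u * iS a) = ps_eps a *: u)].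

End Defs.

Definition black (R : fieldType) (U H : algType R) (iU : U -> H) (pr : H -> U)
  (h : H) (f : U) : U := pr (h * iU f).

(* Main.v *)
Require Import Defs.
From HB Require Import structures.
From mathcomp Require Import all_boot all_order all_algebra.
From mathcomp Require Import mpoly.
From mathcomp Require Import boolp ring.
Import GRing.Theory.
Local Open Scope ring_scope.
Set Implicit Arguments. Unset Strict Implicit. Unset Printing Implicit Defensive.

(* Everything follows from the two commutation rules
     D_v O = O C_v   and   D_v O^-1 = - C_v O^-1,
   where D_v = (- <| x_v) and C_v is the constant matrix C^a_{b v}. They say that
   O^c_a x_v - x_v O^c_a is a combination of the entries O^c_b, so that
   multiplicativity gives O^c_a u = (O^b_a |> u) O^c_b in H for u in U. The five
   claims are then inductions on u along products of generators; (4) comes from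
   x_b (O^-1)^b_a |> u = u x_a.

   With M the matrix of linear forms, the Jacobi identity reads
   [M, C_v] = C_g M^g_v, hence C_b phi^b_v = sum_l b_l ad_M^l (C_v), and the
   commutation rules become, in each degree N, the identity
     sum_{k+l=N} b_l / (k+1)! sum_{i+j=k} L^i Q^j (L-Q)^l = L^N / N!
   for commuting operators L and Q: left and right multiplication by M for O,
   right and left multiplication by -M for O^-1. It is the degree N part of
   (e^L - e^Q)/A * A/(1 - e^-A) = e^L with A = L - Q. *)

(** * Homogeneous components of power series and of matrix series *)

Section HomogeneousComponents.
Variables (R : fieldType) (n : nat).
Implicit Types (a b : ps R n) (N : nat).

(* A power series is handled through its homogeneous components, which are
   polynomials, so that no ring structure on [ps] is needed. *)
Definition hcomp a N : {mpoly R[n]} :=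
  \sum_(m : 'X_{1..n < N.+1}) (if mdeg m == N then a m else 0) *: 'X_[m].

Lemma mcoeff_hcomp a N (m : 'X_{1..n}) :
  (hcomp a N)@_m = if mdeg m == N then a m else 0.
Proof.
have [le_mN|lt_Nm] := leqP (mdeg m) N.
  exact: (mcoeff_mpoly (fun k => if mdeg k == N then a k else 0)).
rewrite raddf_sum big1 ?gtn_eqF // => p _ /=.
rewrite mcoeffZ mcoeffX; have [eq_pm|_] := eqVneq (val p) m; last by rewrite mulr0.
by move: (valP p) lt_Nm => /=; rewrite eq_pm ltnS leqNgt => /negP.
Qed.

Lemma hcomp_inj a b : (forall N, hcomp a N = hcomp b N) -> a = b.
Proof.
move=> eq_ab; apply: funext => m.
by have := congr1 (mcoeff m) (eq_ab (mdeg m)); rewrite !mcoeff_hcomp eqxx.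
Qed.

Lemma mcoeffM_lem (p q : {mpoly R[n]}) (m : 'X_{1..n}) :
  (p * q)@_m = \sum_(k : 'X_{1..n < (mdeg m).+1} | (k <= m)%MM) p@_k * q@_(m - k).
Proof. exact: mcoeff_poly_mul_lin. Qed.

(** A splitting m = p + (m - p) of a monomial of degree N contributes to exactly one k, namely the
    degree of m - p. *)
Lemma hcomp_mul a b N :
  hcomp (ps_mul a b) N = \sum_(k < N.+1) hcomp a (N - k) * hcomp b k.
Proof.
apply/mpolyP => m; rewrite mcoeff_hcomp raddf_sum /=.
under eq_bigr => k _ do rewrite mcoeffM_lem.
rewrite exchange_big /=; case: eqP => [eq_mN | neq_mN]; last first.
  rewrite big1 // => p le_pm; rewrite big1 // => k _; rewrite !mcoeff_hcomp.
  case: eqP => [dp|_]; last by rewrite mul0r.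
  case: eqP => [dq|_]; last by rewrite mulr0.
  by case: neq_mN; rewrite -(submK le_pm) mdegD dp dq subnKC // -ltnS.
apply: eq_bigr => p le_pm.
have dm : (mdeg (m - p) + mdeg p = N)%N by rewrite -mdegD submK.
have lt_qN : (mdeg (m - p) < N.+1)%N by rewrite -dm ltnS leq_addr.
rewrite (bigD1 (Ordinal lt_qN)) //= big1 => [|k neq_k].
  by rewrite addr0 !mcoeff_hcomp eqxx -[in (N - _)%N]dm addKn eqxx.
by rewrite [X in _ * X]mcoeff_hcomp eq_sym (negPf (neq_k : val k != _)) mulr0.
Qed.

Lemma hcomp_deriv i a N : hcomp (ps_deriv i a) N = (hcomp a N.+1)^`M(i).
Proof.
apply/mpolyP => m; rewrite mcoeff_mderiv !mcoeff_hcomp mdegD mdeg1 addn1 eqSS.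
by case: eqP => _; rewrite ?mul0rn // /ps_deriv mulr_natl.
Qed.

Lemma hcomp_scale c a N : hcomp (ps_scale c a) N = c *: hcomp a N.
Proof.
by apply/mpolyP => m; rewrite mcoeffZ !mcoeff_hcomp; case: eqP; rewrite ?mulr0.
Qed.

Lemma hcomp_opp a N : hcomp (ps_opp a) N = - hcomp a N.
Proof.
by apply/mpolyP => m; rewrite mcoeffN !mcoeff_hcomp; case: eqP; rewrite ?oppr0.
Qed.

Lemma hcomp_sum (I : finType) (F : I -> ps R n) N :
  hcomp (ps_sum F) N = \sum_i hcomp (F i) N.
Proof.
apply/mpolyP => m; rewrite mcoeff_hcomp raddf_sum /=.
under eq_bigr do rewrite mcoeff_hcomp.
by case: eqP => // _; rewrite big1.
Qed.

Lemma hcompC c N : hcomp (@psC R n c) N = if N == 0 then c%:MP else 0.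
Proof.
apply/mpolyP => m; rewrite mcoeff_hcomp /psC.
have [->|nz_m] := eqVneq m 0%MM.
  by rewrite mdeg0 eq_sym; case: eqP; rewrite ?mcoeff0 // mcoeffC eqxx mulr1.
rewrite if_same; case: eqP; rewrite ?mcoeff0 // mcoeffC (negPf nz_m) mulr0 //.
Qed.

Lemma hcompX i N : hcomp (@psX R n i) N = if N == 1%N then 'X_i else 0.
Proof.
apply/mpolyP => m; rewrite mcoeff_hcomp /psX.
have [->|neq_m] := eqVneq m U_(i)%MM.
  by rewrite mdeg1 eq_sym; case: eqP; rewrite ?mcoeff0 // mcoeffX eqxx.
by rewrite if_same; case: eqP; rewrite ?mcoeff0 // mcoeffX eq_sym (negPf neq_m).
Qed.

(** When each F k is homogeneous of degree k, only the last term of the truncated sum reaches a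
    monomial of degree N. *)
Lemma hcomp_series (F : nat -> ps R n) N :
  (forall k K, k != K -> hcomp (F k) K = 0) ->
  hcomp (ps_series F) N = hcomp (F N) N.
Proof.
move=> homF; apply/mpolyP => m; rewrite !mcoeff_hcomp; case: eqP => // <-.
rewrite /ps_series big_ord_recr /= big1 ?add0r // => k _.
have := congr1 (mcoeff m) (homF k (mdeg m) (negbT (ltn_eqF (ltn_ord k)))).
by rewrite mcoeff_hcomp eqxx mcoeff0.
Qed.

Lemma eps_hcomp a : ps_eps a = (hcomp a 0)@_0%MM.
Proof. by rewrite mcoeff_hcomp mdeg0 eqxx. Qed.

Lemma hcomp_mx_pow (A : psmat R n) (M : 'M[{mpoly R[n]}]_n) k N i j :
  (forall N i j, hcomp (A i j) N = if N == 1%N then M i j else 0) ->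
  hcomp (psmat_pow A k i j) N = if N == k then (M ^+ k) i j else 0.
Proof.
move=> homA; elim: k N i j => [|k IHk] N i j.
  by rewrite hcompC expr0 mxE; case: ifP => // _; case: eqP; rewrite ?mpolyC1 ?mpolyC0.
rewrite /= /psmat_mul hcomp_sum exprS mxE.
case: eqP => [->|neqN].
  apply: eq_bigr => d _; rewrite hcomp_mul.
  (* By induction the second factor lives in degree k only, so the convolution has one nonzero
     term. *)
  rewrite (bigD1 (inord k)) //= big1 => [|l neq_l].
    by rewrite inordK // addr0 IHk homA eqxx subSnn eqxx.
  rewrite IHk; case: eqP => [eq_l|_]; last by rewrite mulr0.
  by case/eqP: neq_l; apply: val_inj; rewrite /= inordK.
rewrite big1 // => d _; rewrite hcomp_mul big1 // => l _; rewrite IHk.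
case: eqP => [eq_l|_]; last by rewrite mulr0.
rewrite homA; case: eqP => [eq_Nl|_]; last by rewrite mul0r.
have le_lN : (l <= N)%N by rewrite -ltnS.
by case: neqN; apply: etrans (esym (subnK le_lN)) _; rewrite eq_Nl eq_l.
Qed.

Lemma hcomp_mx_series c (A : psmat R n) (M : 'M[{mpoly R[n]}]_n) N i j :
  (forall N i j, hcomp (A i j) N = if N == 1%N then M i j else 0) ->
  hcomp (psmat_series c A i j) N = c N *: (M ^+ N) i j.
Proof.
move=> homA; rewrite hcomp_series => [|k K].
  by rewrite hcomp_scale (hcomp_mx_pow _ _ _ _ homA) eqxx.
by rewrite eq_sym hcomp_scale (hcomp_mx_pow _ _ _ _ homA) => /negPf ->; rewrite scaler0.
Qed.

End HomogeneousComponents.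

(** * An exponential identity for two commuting operators *)

Section CommutingOperators.
Variables (K : comNzRingType) (V : lmodType K) (L Q : {linear V -> V}).
Hypothesis commLQ : forall v, L (Q v) = Q (L v).
Let ad v := L v - Q v.

Let comm_iter k v : Q (iter k L v) = iter k L (Q v).
Proof. by elim: k => //= k <-. Qed.

Let iterB k v w : iter k L (v - w) = iter k L v - iter k L w.
Proof. by elim: k => //= k ->; rewrite linearB. Qed.

(** With A = L - Q, both sides are (L^(k+1) - (L - A)^(k+1)) / A, the right one expanded by the
    binomial theorem. As A cannot be divided out, the proof is by induction on k. *)
Lemma divided_difference_expansion k v :
  \sum_(i < k.+1) iter i L (iter (k - i) Q v) =
  \sum_(s < k.+1) ((-1) ^+ s * 'C(k.+1, s.+1)%:R) *: iter (k - s) L (iter s ad v).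
Proof.
elim: k => [|k IHk]; first by rewrite !big_ord1 /= mulr1 scale1r.
rewrite big_ord_recr /= subnn /=.
(* All terms but L^(k+1) contain a factor Q, which is pulled out of the sum; below, Q is replaced by
   L - A. *)
under eq_bigr => i _ do rewrite subSn -1?ltnS // iterS -comm_iter.
rewrite -linear_sum {}IHk linear_sum.
under [X in X + _]eq_bigr => s _.
  rewrite linearZZ comm_iter.
  rewrite (_ : Q (iter s ad v) = L (iter s ad v) - iter s.+1 ad v); last first.
    by rewrite iterS {2}/ad opprB addrC subrK.
  rewrite iterB -iterSr -subSn -1?ltnS // scalerBr; over.
rewrite sumrB addrAC -addrA.
(* Pascal's rule: the L part of Q carries C(k+1, s+1) and the A part C(k+1, s), whose s = 0 term is
   the L^(k+1) set aside. *)
under [RHS]eq_bigr => s _ do rewrite binS natrD mulrDr scalerDl.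
rewrite [RHS]big_split /=; congr (_ + _).
  by rewrite [RHS]big_ord_recr /= bin_small // mulr0 scale0r addr0.
rewrite [RHS]big_ord_recl /= bin0 mulr1 scale1r -sumrN; congr (_ + _).
apply: eq_bigr => s _.
by rewrite /bump /= add1n subSS exprS mulN1r mulNr scaleNr.
Qed.

Variables (f b : nat -> K).
Hypothesis fact_f : forall k, k`!%:R * f k = 1.
Hypothesis recip_b :
  forall t, \sum_(l < t.+1) b l * ((-1) ^+ (t - l) * f (t - l).+1) = (t == 0)%:R.

(** Factorials are not assumed cancellable in [K]; instead the factors i! f(i) and j! f(j), both
    equal to 1, are inserted. *)
Let bin_f i j : 'C(i + j, i)%:R * f (i + j) = f i * f j.
Proof.
have /(congr1 (GRing.natmul (1 : K))) := bin_fact (leq_addr j i).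
rewrite addKn !natrM => eq_f.
transitivity ('C(i + j, i)%:R * f (i + j) * (i`!%:R * f i) * (j`!%:R * f j)).
  by rewrite !fact_f !mulr1.
transitivity (('C(i + j, i)%:R * (i`!%:R * j`!%:R)) * f (i + j) * (f i * f j)).
  by ring.
by rewrite eq_f fact_f mul1r.
Qed.

(** Here f(k) plays 1/k!, and b is the inverse of the series sum_s (-1)^s f(s+1) t^s = (1 - e^-t)/t.
    After the divided differences are expanded, this inversion kills every positive power of L -
    Q. *)
Lemma exp_derivation_identity N v :
  \sum_(l < N.+1) (b l * f (N - l).+1) *:
    (\sum_(i < (N - l).+1) iter i L (iter (N - l - i) Q (iter l ad v)))
  = f N *: iter N L v.
Proof.
(* The index t = l + s is the total power of L - Q; [bin_f] splits C(N-l+1, s+1) f(N-l+1) into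
   f(s+1) f(N-t). *)
pose G l t := (b l * ((-1) ^+ (t - l) * f (t - l).+1) * f (N - t))
               *: iter (N - t) L (iter t ad v).
transitivity (\sum_(l < N.+1) \sum_(t < N.+1 | (l <= t)%N) G l t).
  apply: eq_bigr => l _; have le_lN : (l <= N)%N by rewrite -ltnS.
  rewrite divided_difference_expansion scaler_sumr.
  transitivity (\sum_(l <= t < N.+1) G l t); last by rewrite big_geq_mkord.
  rewrite -[X in \sum_(X <= _ < _) _]add0n big_addn subSn //.
  rewrite !big_mkord; apply: eq_bigr => -[s lt_s] _ /=.
  have le_s : (s <= N - l)%N by rewrite -ltnS.
  rewrite /G addnK iterD scalerA -subnDA addnC; congr (_ *: _).
  rewrite -!mulrA; congr (_ * _); rewrite mulrCA; congr (_ * _).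
  rewrite mulrC addnC subnDA -bin_f.
  by rewrite addSn subnKC.
(* For fixed t the sum over l is the one in [recip_b], so only t = 0 survives. *)
rewrite (exchange_big_dep xpredT) //=.
transitivity (\sum_(t < N.+1)
    ((t == 0 :> nat)%:R * f (N - t)) *: iter (N - t) L (iter t ad v)).
  apply: eq_bigr => t _; rewrite -recip_b mulr_suml scaler_suml.
  by rewrite (big_ord_widen _ (fun l => G l t) (ltn_ord t)).
rewrite big_ord_recl /= subn0 mul1r big1 ?addr0 // => t _.
by rewrite mul0r scale0r.
Qed.

End CommutingOperators.

(** * Leibniz rule for matrices of polynomials *)

Section MatrixDerivation.
Variables (R : fieldType) (n m : nat) (i : 'I_n).
Implicit Types (A B : 'M[{mpoly R[n]}]_m).

Lemma mderiv_mulmx A B :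
  map_mx (mderiv i) (A * B) = map_mx (mderiv i) A * B + A * map_mx (mderiv i) B.
Proof.
apply/matrixP => a b; rewrite !mxE raddf_sum -big_split /=.
by apply: eq_bigr => c _; rewrite !mxE mderivM.
Qed.

Lemma mderiv_expmx A k :
  map_mx (mderiv i) (A ^+ k.+1)
  = \sum_(j < k.+1) A ^+ j * map_mx (mderiv i) A * A ^+ (k - j).
Proof.
elim: k => [|k IHk]; first by rewrite big_ord1 expr0 mul1r mulr1.
rewrite exprS mderiv_mulmx IHk [RHS]big_ord_recl expr0 mul1r subn0; congr (_ + _).
rewrite mulr_sumr; apply: eq_bigr => j _.
by rewrite /= /bump add1n subSS exprS !mulrA.
Qed.

End MatrixDerivation.

(** * Bernoulli numbers and the series t / (1 - e^-t) *)

Section Bernoulli.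
Variable R : fieldType.
Hypothesis char0 : [pchar R] =i pred0.

Lemma natf_neq0_char0 k : k.+1%:R != 0 :> R.
Proof. by move/pcharf0P: char0 => ->. Qed.

Lemma factf_neq0 k : k`!%:R != 0 :> R.
Proof. by case: k`! (fact_gt0 k) => // ? _; apply: natf_neq0_char0. Qed.

Lemma size_bern_list m : size (bern_list R m) = m.+1.
Proof. by elim: m => //= m IHm; rewrite size_rcons IHm. Qed.

Lemma nth_bern_list m k : (k <= m)%N -> nth 0 (bern_list R m) k = bernoulli R k.
Proof.
elim: m => [|m IHm]; first by case: k.
rewrite leq_eqVlt => /predU1P[-> //|lt_km].
by rewrite /= nth_rcons size_bern_list lt_km IHm.
Qed.

Lemma bernoulliS m :
  bernoulli R m.+1 =
  - (m.+2%:R)^-1 * \sum_(k < m.+1) 'C(m.+2, k)%:R * bernoulli R k.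
Proof.
rewrite /bernoulli /= nth_rcons size_bern_list ltnn eqxx; congr (_ * _).
by apply: eq_bigr => k _; rewrite nth_bern_list // -ltnS.
Qed.

Lemma sum_bin_bernoulli m :
  \sum_(k < m.+1) 'C(m.+1, k)%:R * bernoulli R k = (m == 0)%:R.
Proof.
case: m => [|m]; first by rewrite big_ord1 bin0 mul1r.
rewrite big_ord_recr /= bernoulliS binSn mulNr mulrN mulrA.
by rewrite divff ?natf_neq0_char0 // mul1r subrr.
Qed.

(** The product of t/(1 - e^-t) and (1 - e^-t)/t is 1: the signs merge into (-1)^t and the
    factorials into C(t+1, l)/(t+1)!, leaving the Bernoulli recursion. *)
Lemma bernoulli_reciprocal t :
  \sum_(l < t.+1) (-1) ^+ l * bernoulli R l / l`!%:R
      * ((-1) ^+ (t - l) * ((t - l).+1)`!%:R^-1) = (t == 0)%:R.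
Proof.
transitivity ((-1) ^+ t / (t.+1)`!%:R
              * \sum_(l < t.+1) 'C(t.+1, l)%:R * bernoulli R l); last first.
  rewrite sum_bin_bernoulli; case: eqP => [->|_]; last by rewrite mulr0.
  by rewrite expr0 invr1 !mulr1.
rewrite mulr_sumr; apply: eq_bigr => -[l lt_l] _ /=.
have le_lt : (l <= t)%N by rewrite -ltnS.
have := bin_fact (leqW le_lt); rewrite subSn // => /(congr1 (GRing.natmul (1 : R))).
rewrite 2!natrM => eq_bin.
have -> : (-1) ^+ t = (-1) ^+ l * (-1) ^+ (t - l) :> R by rewrite -exprD subnKC.
(* Factoring (t+1)! through the binomial coefficient shows that the latter is nonzero too, as
   [field] requires. *)
have := factf_neq0 l; have := factf_neq0 (t - l).+1; have := factf_neq0 t.+1.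
rewrite -eq_bin !mulf_eq0 !negb_or => /andP[nz_bin _] nz_tl nz_l.
by field; rewrite nz_bin nz_tl nz_l.
Qed.

End Bernoulli.

(** * The adjoint matrices and the commutation rules for O and its inverse *)

Section AdjointMatrix.
Variables (R : fieldType) (n : nat) (C : 'I_n -> 'I_n -> 'I_n -> R).
Hypotheses (hanti : lie_antisym C) (hjac : lie_jacobi C).
Hypothesis char0 : [pchar R] =i pred0.
Local Notation S := {mpoly R[n]}.

(** By antisymmetry this is the matrix of - ad x_v. *)
Definition Cconst (v : 'I_n) : 'M[S]_n := \matrix_(a, b) (C a b v)%:MP.
Definition Cpoly : 'M[S]_n := \matrix_(a, b) \sum_g C a b g *: 'X_g.

Lemma Cpoly_sum : Cpoly = \sum_g 'X_g *: Cconst g.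
Proof.
apply/matrixP => a b; rewrite mxE summxE; apply: eq_bigr => g _.
by rewrite !mxE mulrC mul_mpolyC.
Qed.

(** The Jacobi identity in matrix form: the adjoint map is a representation. *)
Lemma commutator_Cconst a b :
  Cconst a *m Cconst b - Cconst b *m Cconst a = \sum_g (C g b a)%:MP *: Cconst g.
Proof.
apply/matrixP => l r; rewrite !mxE summxE -sumrB.
apply/eqP; rewrite -subr_eq0 -sumrB -[X in _ == X]mpolyC0; apply/eqP.
rewrite -[in RHS](hjac l r b a) rmorph_sum; apply: eq_bigr => s _ /=.
rewrite !mxE (hanti l s r) (hanti s a r) -!mpolyCM -!mpolyCB; congr (_%:MP).
ring.
Qed.

Lemma commutator_Cpoly v :
  Cpoly *m Cconst v - Cconst v *m Cpoly = \sum_g Cpoly g v *: Cconst g.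
Proof.
rewrite Cpoly_sum mulmx_suml mulmx_sumr -sumrB.
transitivity (\sum_a \sum_g ('X_a * (C g v a)%:MP) *: Cconst g).
  apply: eq_bigr => a _; rewrite -scalemxAl -scalemxAr -scalerBr commutator_Cconst.
  by rewrite scaler_sumr; apply: eq_bigr => g _; rewrite scalerA.
rewrite exchange_big; apply: eq_bigr => g _; rewrite -scaler_suml summxE.
by congr (_ *: _); apply: eq_bigr => a _; rewrite !mxE.
Qed.

(** Turns the powers of M inside phi into iterated commutators, to which the operator identity
    applies. *)
Lemma iter_commutator_Cpoly k v :
  iter k (fun Z => Cpoly *m Z - Z *m Cpoly) (Cconst v)
  = \sum_b (Cpoly ^+ k) b v *: Cconst b.
Proof.
elim: k => [|k IHk] /=.
  rewrite (bigD1 v) //= big1 => [|b neq_b]; rewrite expr0 !mxE.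
    by rewrite eqxx scale1r addr0.
  by rewrite (negPf neq_b) scale0r.
rewrite IHk mulmx_sumr mulmx_suml -sumrB exprS.
under [LHS]eq_bigr do
  rewrite -scalemxAl -scalemxAr -scalerBr commutator_Cpoly scaler_sumr.
rewrite exchange_big; apply: eq_bigr => g _ /=; rewrite mxE scaler_suml.
by apply: eq_bigr => b _; rewrite scalerA mulrC.
Qed.

Lemma mderiv_Cpoly b : map_mx (mderiv b) Cpoly = Cconst b.
Proof.
apply/matrixP => i j; rewrite !mxE raddf_sum (bigD1 b) //= big1 => [|g neq_g].
  rewrite mderivZ mderivX mnm1E eqxx -{1}[U_(b)%MM]add0m addmK.
  by rewrite mpolyX0 scale1r addr0 -mul_mpolyC mulr1.
by rewrite mderivZ mderivX mnm1E (negPf neq_g) scale0r scaler0.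
Qed.

Let f k : R := (k`!%:R)^-1.
Let b k : R := (-1) ^+ k * bernoulli R k / k`!%:R.

Let fact_f k : k`!%:R * (f k)%:MP = 1 :> S.
Proof. by rewrite -mpolyC_nat -mpolyCM divff ?factf_neq0 ?mpolyC1. Qed.

Let recip_b t :
  \sum_(l < t.+1) (b l)%:MP * ((-1) ^+ (t - l) * (f (t - l).+1)%:MP)
  = (t == 0)%:R :> S.
Proof.
rewrite -mpolyC_nat -(bernoulli_reciprocal char0 t) rmorph_sum.
apply: eq_bigr => l _ /=; rewrite (mpolyCM _ (b l)) (mpolyCM _ (_ ^+ _)).
by rewrite rmorphXn /= rmorphN1.
Qed.

Lemma iter_mulmxE (A Z : 'M[S]_n) k : iter k (mulmx A) Z = A ^+ k *m Z.
Proof. by elim: k => /= [|k ->]; rewrite ?mul1mx // exprS -mulmxA. Qed.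

Lemma iter_mulmxrE (A Z : 'M[S]_n) k : iter k (mulmxr A) Z = Z *m A ^+ k.
Proof. by elim: k => /= [|k ->]; rewrite ?mulmx1 // exprSr -mulmxA. Qed.

Lemma mulmx_mulmxrC (A Z : 'M[S]_n) : mulmx A (mulmxr A Z) = mulmxr A (mulmx A Z).
Proof. exact: mulmxA. Qed.

Lemma mderiv_exp_Cpoly N v :
  \sum_(k < N.+1) ((b k)%:MP * (f (N - k).+1)%:MP) *:
     \sum_a (Cpoly ^+ k) a v *: map_mx (mderiv a) (Cpoly ^+ (N - k).+1)
  = (f N)%:MP *: (Cpoly ^+ N *m Cconst v).
Proof.
rewrite -iter_mulmxE.
rewrite -(exp_derivation_identity (mulmx_mulmxrC Cpoly)
  (f := fun k => (f k)%:MP) (b := fun k => (b k)%:MP) fact_f recip_b).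
apply: eq_bigr => k _; congr (_ *: _); rewrite iter_commutator_Cpoly.
under [RHS]eq_bigr => i _ do
  rewrite iter_mulmxE iter_mulmxrE mulmxA mulmx_sumr mulmx_suml.
rewrite exchange_big; apply: eq_bigr => a _ /=.
rewrite mderiv_expmx mderiv_Cpoly scaler_sumr; apply: eq_bigr => i _.
by rewrite -scalemxAr -scalemxAl.
Qed.

Lemma mderiv_exp_oppCpoly N v :
  \sum_(k < N.+1) ((b k)%:MP * (f (N - k).+1)%:MP) *:
     \sum_a (Cpoly ^+ k) a v *: map_mx (mderiv a) ((- Cpoly) ^+ (N - k).+1)
  = - ((f N)%:MP *: (Cconst v *m (- Cpoly) ^+ N)).
Proof.
rewrite -iter_mulmxrE.
(* L is right and Q left multiplication by -M, so L - Q is again the commutator with M. *)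
have commLQ (Z : 'M[S]_n) := esym (mulmx_mulmxrC (- Cpoly) Z).
rewrite -(exp_derivation_identity commLQ (f := fun k => (f k)%:MP)
  (b := fun k => (b k)%:MP) fact_f recip_b) -sumrN.
apply: eq_bigr => k _; rewrite -scalerN; congr (_ *: _).
rewrite (eq_iter (f' := fun Z => Cpoly *m Z - Z *m Cpoly)); last first.
  by move=> Z /=; rewrite mulmxN mulNmx opprK addrC.
rewrite iter_commutator_Cpoly.
under [X in _ = - X]eq_bigr => i _ do
  rewrite iter_mulmxE iter_mulmxrE mulmx_sumr mulmx_suml.
rewrite exchange_big -sumrN; apply: eq_bigr => a _ /=.
(* Leibniz indexes by the left exponent, the operator identity by the right one: the sum is
   reversed. *)
rewrite mderiv_expmx scaler_sumr -sumrN (reindex_inj rev_ord_inj).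
apply: eq_bigr => i _ /=.
rewrite subSS subKn -1?ltnS // -scalemxAr -scalemxAl -scalerN; congr (_ *: _).
by rewrite map_mxN mderiv_Cpoly mulrN mulNr.
Qed.

Lemma hcomp_Cmat N i j :
  hcomp (Cmat C i j) N = if N == 1%N then Cpoly i j else 0.
Proof.
rewrite hcomp_sum mxE.
under eq_bigr do rewrite hcomp_scale hcompX.
by case: eqP => _ //; rewrite big1 // => g _; rewrite scaler0.
Qed.

Lemma hcomp_Omat N i j :
  hcomp (Omat C i j) N = (f N)%:MP * (Cpoly ^+ N) i j.
Proof. by rewrite (hcomp_mx_series _ _ _ _ hcomp_Cmat) mul_mpolyC. Qed.

Lemma hcomp_Oinv N i j :
  hcomp (Oinv C i j) N = (f N)%:MP * ((- Cpoly) ^+ N) i j.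
Proof.
rewrite (hcomp_mx_series _ (M := - Cpoly)) ?mul_mpolyC // => K a c.
by rewrite hcomp_opp hcomp_Cmat [in RHS]mxE; case: eqP; rewrite ?oppr0.
Qed.

Lemma hcomp_phi N i j :
  hcomp (phi C i j) N = (b N)%:MP * (Cpoly ^+ N) i j.
Proof. by rewrite (hcomp_mx_series _ _ _ _ hcomp_Cmat) mul_mpolyC. Qed.

(** Differentiation lowers the degree by one, so degree k of phi meets degree N - k + 1 of [a]. *)
Lemma hcomp_Dact v a N :
  hcomp (Dact C v a) N =
  \sum_(k < N.+1) \sum_d (b k)%:MP * ((Cpoly ^+ k) d v * (hcomp a (N - k).+1)^`M(d)).
Proof.
rewrite hcomp_sum [RHS]exchange_big; apply: eq_bigr => d _ /=.
rewrite hcomp_mul; apply: eq_bigr => k _.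
by rewrite hcomp_deriv hcomp_phi mulrC mulrA.
Qed.

Lemma Dact_Omat v g a :
  Dact C v (Omat C g a) = ps_sum (fun r => ps_scale (C r a v) (Omat C g r)).
Proof.
apply: hcomp_inj => N; rewrite hcomp_Dact hcomp_sum.
have /matrixP/(_ g a) := mderiv_exp_Cpoly N v; rewrite summxE.
rewrite [RHS]mxE [X in _ * X]mxE mulr_sumr => eq_N.
transitivity (\sum_r (f N)%:MP * ((Cpoly ^+ N) g r * Cconst v r a)); last first.
  by apply: eq_bigr => r _; rewrite hcomp_scale hcomp_Omat mxE -mul_mpolyC; ring.
rewrite -{}eq_N; apply: eq_bigr => k _; rewrite [RHS]mxE summxE mulr_sumr.
apply: eq_bigr => d _; rewrite hcomp_Omat mderiv_mulC 2![in RHS]mxE; ring.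
Qed.

Lemma Dact_Oinv v g a :
  Dact C v (Oinv C g a) =
  ps_opp (ps_sum (fun r => ps_scale (C g r v) (Oinv C r a))).
Proof.
apply: hcomp_inj => N; rewrite hcomp_Dact hcomp_opp hcomp_sum.
have /matrixP/(_ g a) := mderiv_exp_oppCpoly N v; rewrite summxE.
rewrite [RHS]mxE 2![in RHS]mxE mulr_sumr => eq_N.
transitivity (- \sum_r (f N)%:MP * (Cconst v g r * ((- Cpoly) ^+ N) r a)); last first.
  by congr (- _); apply: eq_bigr => r _;
     rewrite hcomp_scale hcomp_Oinv [Cconst _ _ _]mxE -mul_mpolyC; ring.
rewrite -{}eq_N; apply: eq_bigr => k _; rewrite [RHS]mxE summxE mulr_sumr.
apply: eq_bigr => d _; rewrite hcomp_Oinv mderiv_mulC 2![in RHS]mxE; ring.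
Qed.

Lemma eps_Omat g a : ps_eps (Omat C g a) = (g == a)%:R.
Proof.
by rewrite eps_hcomp hcomp_Omat expr0 mxE /f invr1 mul1r mcoeffMn mcoeff1 eqxx.
Qed.

Lemma eps_Oinv g a : ps_eps (Oinv C g a) = (g == a)%:R.
Proof.
by rewrite eps_hcomp hcomp_Oinv expr0 mxE /f invr1 mul1r mcoeffMn mcoeff1 eqxx.
Qed.

End AdjointMatrix.

(** * Induction on an enveloping algebra along products of generators *)

(* Bundling the closure proofs with the predicate lets the algebra structure of
   [subalgebra] be inferred from its type. *)
Record subalg_pred (R : fieldType) (U : algType R) := SubalgPred {
  subalg_prop :> U -> Prop;
  subalg_prop1 : subalg_prop 1;
  subalg_propL : forall (c : R) u v,
    subalg_prop u -> subalg_prop v -> subalg_prop (c *: u + v);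
  subalg_propM : forall u v, subalg_prop u -> subalg_prop v -> subalg_prop (u * v)
}.

Section Subalgebra.
Variables (R : fieldType) (U : algType R) (P : subalg_pred U).

Definition subalg_carrier : {pred U} := fun u => `[< P u >].

Fact subalg_carrier_closed : subalg_closed subalg_carrier.
Proof.
split=> [|c u v /asboolP Pu /asboolP Pv|u v /asboolP Pu /asboolP Pv].
- exact/asboolP/subalg_prop1.
- exact/asboolP/subalg_propL.
- exact/asboolP/subalg_propM.
Qed.

HB.instance Definition _ :=
  GRing.isSubalgClosed.Build R U subalg_carrier subalg_carrier_closed.

Record subalgebra :=
  Subalgebra { subalgebra_val : U; _ : subalgebra_val \in subalg_carrier }.
HB.instance Definition _ := [isSub for subalgebra_val].
HB.instance Definition _ := [Choice of subalgebra by <:].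
HB.instance Definition _ := [SubChoice_isSubAlgebra of subalgebra by <:].
End Subalgebra.

(* The universal property retracts U onto the subalgebra cut out by P. *)
Lemma enveloping_ind (R : fieldType) (n : nat) (C : 'I_n -> 'I_n -> 'I_n -> R)
  (U : algType R) (x : 'I_n -> U) (P : U -> Prop) :
  is_enveloping C x -> P 1 ->
  (forall c u v, P u -> P v -> P (c *: u + v)) ->
  (forall u v, P u -> P v -> P (u * v)) ->
  (forall i, P (x i)) -> forall u, P u.
Proof.
move=> [relx univ] P1 PL PM Px.
pose Q := SubalgPred P1 PL PM.
have Qx i : x i \in subalg_carrier Q by apply/asboolP.
pose y i := Subalgebra (Qx i).
have rely : lie_rel C y.
  by move=> m v; apply: val_inj; rewrite rmorphB !rmorphM raddf_sum /= relx.
have [[s [[sL sM s1] sx]] _] := univ _ y rely.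
have [_ uniq_hom] := univ U x relx.
move=> u; have -> : u = val (s u); last exact/asboolP/(valP (s u)).
apply: (uniq_hom id (val \o s)) => //=; last by move=> i; rewrite sx.
split=> [c a b|a b|] /=.
- by rewrite sL.
- by rewrite sM.
- by rewrite s1.
Qed.

(** * Linear maps given as bare functions *)

Section LinearSum.
Variables (R : pzRingType) (V W : lmodType R) (f : V -> W).
Hypothesis fL : linear f.
Let fLin : {linear V -> W} :=
  HB.pack_for {linear V -> W} f (GRing.isLinear.Build R V W _ f fL).

Lemma lin0 : f 0 = 0.
Proof. exact: (linear0 fLin). Qed.

Lemma linZ c u : f (c *: u) = c *: f u.
Proof. exact: (linearZZ fLin). Qed.

Lemma lin_sum (I : finType) (F : I -> V) : f (\sum_i F i) = \sum_i f (F i).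
Proof. exact: (linear_sum fLin). Qed.

End LinearSum.

(** * The black action and matrix coefficients *)

Section BlackAction.
Variables (R : fieldType) (n : nat) (C : 'I_n -> 'I_n -> 'I_n -> R).
Variables (U : algType R) (x : 'I_n -> U) (hU : is_enveloping C x).
Variables (H : algType R) (iU : U -> H) (iS : ps R n -> H) (pr : H -> U).
Hypothesis hH : smash_product C x iU iS pr.
Local Notation bl := (black iU pr).

Lemma iU_linear c u v : iU (c *: u + v) = c *: iU u + iU v.
Proof. by case: hH => -[]. Qed.
Lemma iU_mul u v : iU (u * v) = iU u * iU v.
Proof. by case: hH => -[]. Qed.
Lemma iU1 : iU 1 = 1.
Proof. by case: hH => -[]. Qed.
Lemma pr_linear c h h' : pr (c *: h + h') = c *: pr h + pr h'.
Proof. by case: hH => _ _ _ _ []. Qed.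
Lemma pr_normal u a : pr (iU u * iS a) = ps_eps a *: u.
Proof. by case: hH => _ _ _ _ []. Qed.

Lemma iS_sum (I : finType) (F : I -> ps R n) : iS (ps_sum F) = \sum_i iS (F i).
Proof.
case: hH => _ [iSD iSZ] _ _ _; rewrite /ps_sum.
elim: (index_enum I) => [|i r IHr].
  (* The value of [iS] at the zero series comes from compatibility with scaling by 0. *)
  rewrite big_nil -(scale0r (iS (@psC R n 0))) -iSZ; congr iS.
  by apply: funext => m; rewrite big_nil /ps_scale mul0r.
rewrite big_cons -IHr -iSD; congr iS.
by apply: funext => m; rewrite big_cons.
Qed.

Lemma black_linear h c u v : bl h (c *: u + v) = c *: bl h u + bl h v.
Proof. by rewrite /black iU_linear mulrDr -scalerAr pr_linear. Qed.

Lemma black_iU u v : bl (iU u) v = u * v.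
Proof.
case: hH => _ _ [_ iS1] _ _.
rewrite /black -iU_mul -[iU _]mulr1 -iS1 pr_normal.
by rewrite /ps_eps /psC eqxx scale1r.
Qed.

(* The entries of T span a matrix coalgebra: T is O transposed, or O^-1. *)
Section MatrixCoaction.
Variables (T : 'I_n -> 'I_n -> ps R n) (E : 'I_n -> 'I_n -> 'I_n -> R).
Hypothesis DactT : forall v a c,
  Dact C v (T a c) = ps_sum (fun b => ps_scale (E v a b) (T b c)).
Hypothesis epsT : forall a c, ps_eps (T a c) = (a == c)%:R.

Lemma sum_delta a (F : 'I_n -> U) : \sum_b (a == b)%:R *: F b = F a.
Proof.
rewrite (bigD1 a) //= eqxx scale1r big1 ?addr0 // => b.
by rewrite eq_sym => /negPf->; rewrite scale0r.
Qed.

(** Reads off one coefficient of a normal form, because the constant terms of T form the identity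
    matrix. *)
Lemma matrix_normal_pr (G : 'I_n -> U) c :
  pr (\sum_b iU (G b) * iS (T b c)) = G c.
Proof.
rewrite (lin_sum pr_linear) -[RHS]sum_delta; apply: eq_bigr => b _.
by rewrite pr_normal epsT eq_sym.
Qed.

Lemma matrix_iU_gen a c v :
  iS (T a c) * iU (x v) =
  \sum_b iU ((a == b)%:R *: x v + (E v a b)%:A) * iS (T b c).
Proof.
case: (hH) => _ [_ iSZ] _ -> _; rewrite DactT iS_sum.
transitivity (\sum_b ((a == b)%:R *: (iU (x v) * iS (T b c)) + E v a b *: iS (T b c))).
  rewrite big_split /=; congr (_ + _); last by apply: eq_bigr => b _; rewrite iSZ.
  rewrite (bigD1 a) //= eqxx scale1r big1 ?addr0 // => b.
  by rewrite eq_sym => /negPf->; rewrite scale0r.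
apply: eq_bigr => b _; rewrite iU_linear (linZ iU_linear) iU1.
by rewrite mulrDl -!scalerAl mul1r.
Qed.

Lemma black_matrix_gen a c v :
  bl (iS (T a c)) (x v) = (a == c)%:R *: x v + (E v a c)%:A.
Proof. by rewrite /black matrix_iU_gen matrix_normal_pr. Qed.

Lemma black_matrix1 a c : bl (iS (T a c)) 1 = (a == c)%:R.
Proof.
by rewrite /black iU1 mulr1 -[iS _]mul1r -iU1 pr_normal epsT scaler_nat.
Qed.

(** Induction on u. For a product, T is moved past one factor and then the other, and [pr]
    identifies the resulting coefficients as values of the action. *)
Lemma matrix_iU u a c :
  iS (T a c) * iU u = \sum_b iU (bl (iS (T a b)) u) * iS (T b c).
Proof.
move: u a c; apply: (enveloping_ind hU)
  => [a c|k u v IHu IHv a c|u v IHu IHv a c|v a c].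
- rewrite iU1 mulr1 (bigD1 a) //= big1 => [|b].
    by rewrite black_matrix1 eqxx iU1 mul1r addr0.
  by rewrite black_matrix1 eq_sym => /negPf ->; rewrite (lin0 iU_linear) mul0r.
- rewrite iU_linear mulrDr -scalerAr IHu IHv scaler_sumr -big_split /=.
  by apply: eq_bigr => b _; rewrite black_linear iU_linear mulrDl scalerAl.
- have IHuv e : iS (T a e) * iU (u * v) =
      \sum_b iU (\sum_d bl (iS (T a d)) u * bl (iS (T d b)) v) * iS (T b e).
    rewrite iU_mul mulrA IHu mulr_suml.
    under eq_bigr do rewrite -mulrA IHv mulr_sumr.
    rewrite exchange_big; apply: eq_bigr => b _ /=.
    rewrite (lin_sum iU_linear) mulr_suml.
    by apply: eq_bigr => d _; rewrite iU_mul mulrA.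
  by rewrite IHuv; apply: eq_bigr => b _; rewrite [in RHS]/black IHuv matrix_normal_pr.
- by rewrite matrix_iU_gen; apply: eq_bigr => b _; rewrite black_matrix_gen.
Qed.

Lemma black_matrixM a c u v :
  bl (iS (T a c)) (u * v) = \sum_b bl (iS (T a b)) u * bl (iS (T b c)) v.
Proof.
rewrite {1}/black iU_mul mulrA matrix_iU mulr_suml.
rewrite (eq_bigr (fun b => \sum_d
    iU (bl (iS (T a b)) u * bl (iS (T b d)) v) * iS (T d c))).
  rewrite exchange_big -[RHS](matrix_normal_pr (fun d =>
    \sum_b bl (iS (T a b)) u * bl (iS (T b d)) v)).
  congr pr; apply: eq_bigr => d _ /=.
  by rewrite (lin_sum iU_linear) mulr_suml.
move=> b _; rewrite -mulrA matrix_iU mulr_sumr.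
by apply: eq_bigr => d _; rewrite iU_mul mulrA.
Qed.

Lemma black_iU_mul u a c v :
  bl (iU u * iS (T a c)) v = u * bl (iS (T a c)) v.
Proof.
rewrite {1}/black -mulrA matrix_iU mulr_sumr.
rewrite -[RHS](matrix_normal_pr (fun b => u * bl (iS (T a b)) v)).
by congr pr; apply: eq_bigr => b _; rewrite iU_mul mulrA.
Qed.

End MatrixCoaction.
End BlackAction.

(** * The five identities *)

Theorem theorem2 (R : fieldType) (hR : [pchar R] =i pred0) (n : nat)
  (C : 'I_n -> 'I_n -> 'I_n -> R)
  (hanti : lie_antisym C) (hjac : lie_jacobi C)
  (U : algType R) (x : 'I_n -> U) (hU : is_enveloping C x)
  (H : algType R) (iU : U -> H) (iS : ps R n -> H) (pr : H -> U)
  (hH : smash_product C x iU iS pr) :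
  let O := Omat C in
  let Oi := Oinv C in
  let bl := black iU pr in
  let y := fun al : 'I_n => \sum_(b < n) iU (x b) * iS (Oi b al) in
  [/\ (forall (al : 'I_n) (f : U),
         x al * f = \sum_(b < n) bl (iS (O b al)) f * x b),
      (forall (al g : 'I_n) (gg f : U),
         bl (iS (O g al)) (gg * f)
         = \sum_(b < n) bl (iS (O b al)) gg * bl (iS (O g b)) f),
      (forall (al g : 'I_n) (gg f : U),
         bl (iS (Oi g al)) (gg * f)
         = \sum_(b < n) bl (iS (Oi g b)) gg * bl (iS (Oi b al)) f),
      (forall (al : 'I_n) (f : U), bl (y al) f = f * x al)
    & (forall (al : 'I_n) (f gg : U),
         bl (iU (x al)) f * gg
         = \sum_(b < n) bl (iS (O b al)) f * bl (iU (x b)) gg)].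
Proof.
move=> O Oi bl y.
(* Transposed so that D_v acts on the first index, as the matrix coalgebra lemmas require; the
   inverse already has this form. *)
pose OT a c := O c a.
have DactO v a c : Dact C v (OT a c) = ps_sum (fun b => ps_scale (C b a v) (OT b c)).
  exact: Dact_Omat.
have epsO a c : ps_eps (OT a c) = (a == c)%:R by rewrite /OT eps_Omat // eq_sym.
have DactOi v a c :
    Dact C v (Oi a c) = ps_sum (fun b => ps_scale (- C a b v) (Oi b c)).
  rewrite Dact_Oinv //; apply: funext => m; rewrite /ps_opp /ps_sum -sumrN.
  by apply: eq_bigr => b _; rewrite /ps_scale mulNr.
have epsOi a c : ps_eps (Oi a c) = (a == c)%:R by apply: eps_Oinv.
have [relx _] := hU.
have blL h k u v : bl h (k *: u + v) = k *: bl h u + bl h v by apply: (black_linear hH).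
have O_mul a c u v :
    bl (iS (OT a c)) (u * v) = \sum_b bl (iS (OT a b)) u * bl (iS (OT b c)) v.
  exact: (black_matrixM hU hH DactO).
have Oi_mul a c u v :
    bl (iS (Oi a c)) (u * v) = \sum_b bl (iS (Oi a b)) u * bl (iS (Oi b c)) v.
  exact: (black_matrixM hU hH DactOi).
have O1 a c : bl (iS (OT a c)) 1 = (a == c)%:R by exact: (black_matrix1 hH epsO).
have Oi1 a c : bl (iS (Oi a c)) 1 = (a == c)%:R by exact: (black_matrix1 hH epsOi).
have O_gen a c v : bl (iS (OT a c)) (x v) = (a == c)%:R *: x v + (C c a v)%:A.
  exact: (black_matrix_gen hH DactO).
have Oi_gen a c v : bl (iS (Oi a c)) (x v) = (a == c)%:R *: x v + (- C a c v)%:A.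
  exact: (black_matrix_gen hH DactOi).
have x_mul a f : x a * f = \sum_b bl (iS (OT a b)) f * x b.
  move: f a; apply: (enveloping_ind hU) => [a|k u v IHu IHv a|u v IHu IHv a|v a].
  - under eq_bigr do rewrite O1 -scaler_nat -scalerAl mul1r.
    by rewrite sum_delta mulr1.
  - rewrite mulrDr -scalerAr IHu IHv scaler_sumr -big_split.
    by apply: eq_bigr => b _; rewrite blL mulrDl scalerAl.
  - rewrite mulrA IHu mulr_suml.
    under eq_bigr do rewrite -mulrA IHv mulr_sumr.
    rewrite exchange_big; apply: eq_bigr => b _ /=.
    by rewrite O_mul mulr_suml; apply: eq_bigr => d _; rewrite mulrA.
  (* On a generator the sum is x_v x_a + [x_a, x_v] = x_a x_v. *)
  - under eq_bigr do
      rewrite O_gen mulrDl -!scalerAl mul1r.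
    rewrite big_split sum_delta /= -relx.
    by rewrite addrC subrK.
have mul_x a f : \sum_b x b * bl (iS (Oi b a)) f = f * x a.
  move: f a; apply: (enveloping_ind hU) => [a|k u v IHu IHv a|u v IHu IHv a|v a].
  - under eq_bigr do rewrite Oi1 -scaler_nat -scalerAr mulr1 eq_sym.
    by rewrite sum_delta mul1r.
  - rewrite mulrDl -scalerAl -IHu -IHv scaler_sumr -big_split.
    by apply: eq_bigr => b _; rewrite blL mulrDr scalerAr.
  - rewrite -mulrA -IHv mulr_sumr.
    under [RHS]eq_bigr do rewrite mulrA -IHu mulr_suml.
    rewrite exchange_big; apply: eq_bigr => b _ /=.
    by rewrite Oi_mul mulr_sumr; apply: eq_bigr => d _; rewrite mulrA.
  (* On a generator the sum is x_a x_v - [x_a, x_v] = x_v x_a. *)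
  - under eq_bigr do
      rewrite Oi_gen mulrDr -!scalerAr mulr1 eq_sym scaleNr.
    rewrite big_split sum_delta /= sumrN.
    by rewrite -relx subKr.
split=> [al f|al g gg f|al g gg f|al f|al f gg].
- exact: x_mul.
- exact: O_mul.
- exact: Oi_mul.
- rewrite -mul_x /bl /black /y mulr_suml (lin_sum (pr_linear hH)).
  by apply: eq_bigr => b _; apply: (black_iU_mul hU hH DactOi).
(* Elements of U act by left multiplication, so (5) is (1) multiplied on the right by [gg]. *)
- rewrite /bl (black_iU hH) -/bl x_mul mulr_suml.
  by apply: eq_bigr => b _; rewrite -mulrA /bl (black_iU hH).
Qed.
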